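(* Let $R$ be a finite commutative Frobenius ring of characteristic $2$, and let $p$ be a prime with $p=4k+1$ for an integer $k$. For $i\in\{0,1,2\}$ let $a_i,b_i,c_i\in R$, let $Q_i=Q_p(a_i,b_i,c_i)$, and let $A_i$ be a $p\times p$ circulant matrix over $R$. Let $\mathcal{C}$ be the linear code of length $6p$ over $R$ generated by the rows of $$M=\left(\begin{array}{ccc|ccc} Q_0&Q_1&Q_2&A_0&A_1&A_2\\ Q_2&Q_0&Q_1&A_2&A_0&A_1\\ Q_1&Q_2&Q_0&A_1&A_2&A_0\end{array}\right).$$ If $\mathcal{C}$ is self-dual, then the matrix $\sum_{i=0}^2Q_i$ is invertible over $R$.
   Context: For $a,b,c\in R$ and a prime $p$, $Q_p(a,b,c)$ is the $p\times p$ circulant matrix (each row is the right cyclic shift by one position of the row above it) whose first row $(r_0,r_1,\dots,r_{p-1})$ is given by $r_0=a$; $r_i=b$ if $i\neq 0$ is a quadratic residue modulo $p$; $r_i=c$ if $i$ is a quadratic non-residue modulo $p$. A code of length $n$ over $R$ is an $R$-submodule of $R^n$; its dual is $\mathcal{C}^\perp=\{x\in R^n : \sum_i x_iy_i=0 \text{ for all } y\in \mathcal{C}\}$ (Euclidean inner product). $\mathcal{C}$ is self-dual if $\mathcal{C}=\mathcal{C}^\perp$. *)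

(* Defs.v *)
From HB Require Import structures.
From mathcomp Require Import all_boot all_algebra.

Set Implicit Arguments.
Unset Strict Implicit.
Unset Printing Implicit Defensive.

Import GRing.Theory.
Local Open Scope ring_scope.

Section Frobenius.

Variable R : finComUnitRingType.
Implicit Types I S : {set R}.

Definition is_ideal I : bool :=
  [&& 0 \in I,
      [forall x in I, forall y in I, x + y \in I]
    & [forall r, forall x in I, r * x \in I]].

Lemma is_idealP I : reflect (submod_closed (I : {set R^o})) (is_ideal I).
Proof.
apply: (iffP and3P) => [[I0 /forall_inP addI /forallP mulI]|[I0 linI]].
  split=> // r x y Ix Iy.
  have /forall_inP mulIr := mulI r.
  by have /forall_inP := addI _ (mulIr x Ix); apply.
split=> //.
  apply/forall_inP=> x Ix; apply/forall_inP=> y Iy.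
  by have := linI 1 x y Ix Iy; rewrite scale1r.
apply/forallP=> r; apply/forall_inP=> x Ix.
by have := linI r x 0 Ix I0; rewrite addr0.
Qed.

Definition maximal_ideal : pred {set R} :=
  maxset (fun I => is_ideal I && (I != [set: R])).

Definition minimal_ideal : pred {set R} :=
  minset (fun I => is_ideal I && (I != [set 0])).

Definition ideal_generated S : {set R} :=
  \bigcap_(I | is_ideal I && (S \subset I)) I.

Definition jacobson_radical : {set R} := \bigcap_(I | maximal_ideal I) I.

(* The sum of the simple submodules of R. *)
Definition socle : {set R} :=
  ideal_generated (\bigcup_(I | minimal_ideal I) I).

(* R / J(R) and Soc(R) are isomorphic as R-modules. The isomorphism is given
   on representatives: f is constant on the cosets of J(R), takes distinct
   values on distinct cosets, and has image Soc(R). *)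
Definition frobenius_ring : Prop :=
  exists f : {linear R^o -> R^o},
    (forall x y : R, f x = f y <-> x - y \in jacobson_radical) /\
    [set f x | x in [set: R]] = socle.

End Frobenius.

Section Codes.

Variable R : finComUnitRingType.

(* All R-linear combinations of the rows of M. *)
Definition row_code m n (M : 'M[R]_(m, n)) : {set 'rV[R]_n} :=
  [set v *m M | v in [set: 'rV[R]_m]].

Definition dual_code n (C : {set 'rV[R]_n}) : {set 'rV[R]_n} :=
  [set x : 'rV[R]_n | [forall y in C, \sum_i x 0 i * y 0 i == 0]].

Definition self_dual n (C : {set 'rV[R]_n}) : Prop := C = dual_code C.

End Codes.

Section Circulant.

Variable R : Type.

Definition right_shift n (r : 'rV[R]_n) : 'rV[R]_n :=
  \row_j r 0 (ord_pred j).

Definition circulant_mx n (r : 'rV[R]_n) : 'M[R]_n :=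
  \matrix_(i < n) iter i (@right_shift n) r.

Definition is_circulant n (A : 'M[R]_n) : Prop :=
  exists r : 'rV[R]_n, A = circulant_mx r.

(* The 3 x 3 block circulant with first block row X 0, X 1, X 2. *)
Definition block_circulant3 n (X : 'I_3 -> 'M[R]_n) :
    'M[R]_(n + (n + n), n + (n + n)) :=
  col_mx (row_mx (X 0) (row_mx (X 1) (X 2)))
 (col_mx (row_mx (X 2) (row_mx (X 0) (X 1)))
         (row_mx (X 1) (row_mx (X 2) (X 0)))).

(* Only meaningful for i prime to p; Q_mx treats i = 0 separately. *)
Definition quadratic_residue (p i : nat) : bool :=
  [exists x : 'I_p, x ^ 2 == i %[mod p]].

Definition Q_mx (p : nat) (a b c : R) : 'M[R]_p :=
  circulant_mx (\row_(i < p)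
    if i == 0 :> nat then a else if quadratic_residue p i then b else c).

End Circulant.

(* Main.v *)
Require Import Defs.
From mathcomp Require Import all_boot all_algebra.
From mathcomp Require Import fingroup perm zify ring.

Set Implicit Arguments.
Unset Strict Implicit.
Unset Printing Implicit Defensive.

Import GRing.Theory.
Local Open Scope ring_scope.

(** Write S and B for the sums of the Q i and of the A i.  The three block rows
    of M add up to (S S S | B B B), so the self-orthogonality of the code gives
    3 (S S^T + B B^T) = 0, that is, S S^T + B B^T = 0 in characteristic 2.

    The rows of M are linearly independent.  Indeed M has m = 3p rows and 2m
    columns, the code is the image of v |-> v M, and its dual is the kernel of
    x |-> x M^T, which has at least |R|^(2m) / |R|^m = |R|^m elements; if the
    code equals its dual, the image of v |-> v M is as large as its domain
    ([self_dual_row_free]).  So a row vector v with v S = v B = 0 vanishes,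
    because (v v v) M = (vS vS vS | vB vB vB).

    Let K be the left kernel of S, a finite set.  Circulants commute, so B maps
    K to K, injectively by the previous remark, hence onto K.  As u B B^T =
    - u S S^T = 0 for u in K, it follows that K B^T = 0.  Reversing the
    coordinates, i |-> -i, conjugates a circulant to its transpose; S is
    symmetric, since -1 is a square modulo p = 4k + 1, so the reversal preserves
    K and turns K B^T = 0 into K B = 0.  Hence K = 0 ([unitmx_of_mul_tr0]), and an
    injective endomorphism of the finite module R^p is invertible. *)

(** * Codes equal to their dual over a finite ring *)

Section Codes.
Variable R : finComUnitRingType.

Lemma in_dual_row_code m n (M : 'M[R]_(m, n)) (x : 'rV[R]_n) :
  (x \in dual_code (row_code M)) = (x *m M^T == 0).
Proof.
rewrite inE; apply/forall_inP/eqP => [dx | xM0 y].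
  apply/rowP => i; rewrite !mxE.
  have /dx/eqP dxi : row i M \in row_code M.
    by apply/imsetP; exists (delta_mx 0 i); rewrite ?inE // -rowE.
  by rewrite -[RHS]dxi; apply: eq_bigr => j _; rewrite !mxE.
case/imsetP => v _ ->.
have : x *m (v *m M)^T = 0 by rewrite trmx_mul mulmxA xM0 mul0mx.
move/rowP/(_ 0); rewrite !mxE => xv0; apply/eqP; rewrite -[RHS]xv0.
by apply: eq_bigr => j _; rewrite [_^T _ _]mxE.
Qed.

Lemma self_dual_mul_tr m n (M : 'M[R]_(m, n)) :
  self_dual (row_code M) -> M *m M^T = 0.
Proof.
move=> sdM; apply/row_matrixP => i; rewrite row_mul row0; apply/eqP.
rewrite -in_dual_row_code -sdM.
by apply/imsetP; exists (delta_mx 0 i); rewrite ?inE // -rowE.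
Qed.

(** The dual is the kernel of x |-> x M^T, and each fibre of this map embeds in
    its kernel by translation. *)
Lemma card_dual_row_code m n (M : 'M[R]_(m, n)) :
  (#|{: 'rV[R]_n}| <= #|{: 'rV[R]_m}| * #|dual_code (row_code M)|)%N.
Proof.
rewrite -[leqLHS]sum1_card (partition_big (mulmxr M^T) xpredT) //=.
rewrite -sum_nat_const [leqRHS](eq_bigl xpredT) //.
apply: leq_sum => y _; rewrite sum1dep_card.
have [|[x0]] := set_0Vmem [set x : 'rV[R]_n | x *m M^T == y].
  by move=> ->; rewrite cards0.
rewrite inE => /eqP x0y; rewrite -(card_imset _ (addIr (- x0))).
apply/subset_leq_card/subsetP => _ /imsetP[x + ->].
by rewrite in_dual_row_code inE mulmxBl x0y subr_eq0.
Qed.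

(** The lower bound on the dual forces the code to have as many elements as
    there are coefficient vectors v, so v |-> v M is injective on a finite
    set. *)
Lemma self_dual_row_free m (M : 'M[R]_(m, m + m)) (v : 'rV[R]_m) :
  self_dual (row_code M) -> v *m M = 0 -> v = 0.
Proof.
move=> sdM vM0; have := card_dual_row_code M; rewrite -sdM.
rewrite !card_mx !mul1n expnD leq_pmul2l ?expn_gt0 => [leC|]; last first.
  by rewrite (cardD1 0) inE.
have /imset_injP inj : #|row_code M| == #|[set: 'rV[R]_m]|.
  by rewrite eqn_leq leq_imset_card cardsT card_mx mul1n.
by apply: inj; rewrite ?inE // vM0 mul0mx.
Qed.

End Codes.

(** * Invertibility from the injectivity of row actions *)

Section Unitmx.
Variable R : finComUnitRingType.

(** The map v |-> v S is then bijective, as its domain is finite, and the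
    preimages of the unit row vectors are the rows of an inverse of S. *)
Lemma unitmx_inj n (S : 'M[R]_n) :
  (forall v : 'rV[R]_n, v *m S = 0 -> v = 0) -> S \in unitmx.
Proof.
move=> S_inj; have injS : injective (fun v : 'rV[R]_n => v *m S).
  move=> u v /= /eqP; rewrite -subr_eq0 -mulmxBl => /eqP/S_inj/eqP.
  by rewrite subr_eq0 => /eqP.
suff /mulmx1_unit[] : (\matrix_i invF injS (delta_mx 0 i)) *m S = 1%:M by [].
by apply/row_matrixP => i; rewrite row_mul rowK (f_invF injS) row1.
Qed.

(** J conjugates B to its transpose and commutes with S; for circulants, it is
    the reversal of the coordinates.  The sum S S^T + B B^T being zero, B^T
    vanishes on the image under B of the left kernel of S, and by finiteness this
    image is the whole kernel.  J preserves this kernel and turns B^T into B, so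
    that B vanishes there as well, which the last hypothesis excludes unless the
    kernel is zero. *)
Lemma unitmx_of_mul_tr0 n (S B J : 'M[R]_n) :
    S *m B = B *m S -> S *m J = J *m S -> B^T *m J = J *m B ->
    J \in unitmx -> S *m S^T + B *m B^T = 0 ->
    (forall v : 'rV[R]_n, v *m S = 0 -> v *m B = 0 -> v = 0) ->
  S \in unitmx.
Proof.
move=> SB SJ BJ unitJ SSBB free; apply: unitmx_inj => v vS0.
pose K := [set u : 'rV[R]_n | u *m S == 0].
have inK u : u \in K -> u *m S = 0 by rewrite inE => /eqP.
have stabK : [set u *m B | u in K] \subset K.
  apply/subsetP => _ /imsetP[u /inK uS0 ->].
  by rewrite inE -mulmxA -SB mulmxA uS0 mul0mx.
have injK : {in K &, injective (mulmxr B)}.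
  move=> u w /inK uS0 /inK wS0 /= /eqP; rewrite -subr_eq0 -mulmxBl => /eqP uw0.
  by apply/subr0_eq/free; rewrite // mulmxBl uS0 wS0 subrr.
have imK : [set u *m B | u in K] = K.
  by apply/eqP; rewrite eqEcard stabK (card_in_imset injK) /=.
have vBT : v *m B^T = 0.
  have : v \in K by rewrite inE vS0.
  rewrite -imK => /imsetP[u /inK uS0 ->].
  have -> : u *m B *m B^T = - (u *m S *m S^T).
    by apply/eqP; rewrite -addr_eq0 addrC -!mulmxA -mulmxDr SSBB mulmx0.
  by rewrite uS0 mul0mx oppr0.
apply: (can_inj (mulmxK unitJ)); rewrite mul0mx; apply: free.
  by rewrite -mulmxA -SJ mulmxA vS0 mul0mx.
by rewrite -mulmxA -BJ mulmxA vBT mul0mx.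
Qed.

End Unitmx.

(** * Circulant matrices *)

Section Circulant.
Variables (R : comPzRingType) (n : nat).
(* The order n + 2 makes the indices a ring, that of the integers modulo it. *)
Implicit Types (r : 'rV[R]_n.+2) (A B : 'M[R]_n.+2).

Lemma circulant_mxE r i j : circulant_mx r i j = r 0 (j - i).
Proof.
have ord_predE (l : 'I_n.+2) : ord_pred l = l - 1.
  by apply: val_inj => /=; rewrite modnDmr (@modn_small 1) // subn1 addnS.
rewrite mxE -[i in RHS]natr_Zp.
elim: (i : nat) j => [j|m IHm j] /=; first by rewrite subr0.
by rewrite mxE IHm ord_predE -addrA -opprD -mulrS.
Qed.

Lemma is_circulantP A :
  is_circulant A <-> exists f : 'I_n.+2 -> R, forall i j, A i j = f (j - i).
Proof.
split=> [[r ->]|[f fE]].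
  by exists (r 0) => i j; rewrite circulant_mxE.
by exists (\row_j f j); apply/matrixP => i j; rewrite circulant_mxE mxE.
Qed.

Lemma is_circulantD A B :
  is_circulant A -> is_circulant B -> is_circulant (A + B).
Proof.
move=> /is_circulantP[f fE] /is_circulantP[g gE].
by apply/is_circulantP; exists (fun i => f i + g i) => i j; rewrite mxE fE gE.
Qed.

Lemma circulant_mulC A B : is_circulant A -> is_circulant B -> A *m B = B *m A.
Proof.
move=> /is_circulantP[f fE] /is_circulantP[g gE].
apply/matrixP => i j; rewrite !mxE.
rewrite (reindex_inj (inv_inj (subKr (i + j)))); apply: eq_bigr => l _ /=.
by rewrite !fE !gE mulrC; congr (g _ * f _); ring.
Qed.

Definition opp_perm : {perm 'I_n.+2} := perm (@oppr_inj 'I_n.+2).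
Definition flip_mx : 'M[R]_n.+2 := perm_mx opp_perm.

Lemma circulant_flip A : is_circulant A -> A^T *m flip_mx = flip_mx *m A.
Proof.
move=> /is_circulantP[f fE].
have opp_permV : (opp_perm^-1)%g = opp_perm.
  by apply/permP => i; apply: (@perm_inj _ opp_perm); rewrite permKV !permE opprK.
rewrite /flip_mx -row_permE -[in LHS]opp_permV -col_permE.
by apply/matrixP => i j; rewrite !mxE !fE !permE !opprK addrC.
Qed.

End Circulant.

(** * Symmetry of quadratic residue circulants *)

(** By Wilson's theorem, (4k)! = -1 modulo p, and the factors i of (4k)! with
    i > 2k are the opposites of the factors p - i, an even number of them, so
    that (4k)! is the square of (2k)!. *)
Lemma neg1_square n k : prime n.+2 -> n.+2 = (4 * k + 1)%N ->
  exists y : 'I_n.+2, y ^+ 2 = -1.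
Proof.
move=> p_pr pE; exists ((2 * k)`!)%:R.
have p0 : n.+2%:R = 0 :> 'I_n.+2 by exact: (@pchar_Zp n.+2).
have : ((n.+1)`!.+1)%:R = 0 :> 'I_n.+2.
  have := @Wilson n.+2 isT; rewrite p_pr => /esym/dvdnP[q ->].
  by rewrite natrM p0 mulr0.
rewrite mulrS addrC => /eqP; rewrite addr_eq0 => /eqP <-.
have -> : ((n.+1)`! = (2 * k + 2 * k)`!)%N by congr (_`!); lia.
rewrite [in RHS]fact_prod (@big_cat_nat _ _ _ (2 * k).+1) /=; [|lia|lia].
rewrite -fact_prod natrM expr2; congr (_ * _).
(* It remains to show that the upper half of (4k)! equals (2k)!: reverse it and
   shift the index, so that it becomes the product of the p - i. *)
rewrite natr_prod fact_prod natr_prod [RHS]big_nat_rev -{2}[(2 * k).+1]add1n.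
rewrite big_addn -addSn addnK.
under [RHS]eq_big_nat => i /andP[i_gt0 i_le].
  have -> : (1 + 2 * k + ((2 * k).+1 + 2 * k) - (i + 2 * k).+1 = n.+2 - i)%N.
    by lia.
  rewrite natrB ?p0 ?sub0r -1?mulN1r; [over|lia].
by rewrite big_split /= prodr_const_nat subSS subn0 exprM sqrrN !expr1n mul1r.
Qed.

Lemma quadratic_residueE n (i : 'I_n.+2) :
  quadratic_residue n.+2 i = [exists x : 'I_n.+2, x ^+ 2 == i].
Proof.
by apply: eq_existsb => x; rewrite -val_eqE /= (modn_small (ltn_ord i)).
Qed.

Lemma quadratic_residueN n k (i : 'I_n.+2) :
    prime n.+2 -> n.+2 = (4 * k + 1)%N ->
  quadratic_residue n.+2 (- i)%R = quadratic_residue n.+2 i.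
Proof.
move=> p_pr pE; have [y y2] := neg1_square p_pr pE.
have residue_opp (j : 'I_n.+2) :
    quadratic_residue n.+2 j -> quadratic_residue n.+2 (- j)%R.
  rewrite !quadratic_residueE => /existsP[x /eqP <-].
  by apply/existsP; exists (y * x); rewrite exprMn y2 mulN1r.
by apply/idP/idP => /residue_opp; rewrite ?opprK.
Qed.

Lemma trmx_Q_mx (R : comPzRingType) n k (a b c : R) :
    prime n.+2 -> n.+2 = (4 * k + 1)%N ->
  (Q_mx n.+2 a b c)^T = Q_mx n.+2 a b c.
Proof.
move=> p_pr pE; apply/matrixP => i j; rewrite mxE !circulant_mxE !mxE -opprB.
rewrite (quadratic_residueN _ p_pr pE).
have eq0E (x : 'I_n.+2) : (x == 0%N :> nat) = (x == 0) by [].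
by rewrite !eq0E oppr_eq0.
Qed.

(** * Sums of block rows and the double circulant code *)

Section BlockCirculant.
Variables (R : comPzRingType) (n : nat).
Implicit Types X : 'I_3 -> 'M[R]_n.

Lemma sum_block_rows m (v : 'M[R]_(m, n)) X :
  let w := v *m \sum_(i < 3) X i in
  row_mx v (row_mx v v) *m block_circulant3 X = row_mx w (row_mx w w).
Proof.
have sumX : \sum_(i < 3) X i = X 0 + X 1 + X 2%:R.
  rewrite 3!big_ord_recl big_ord0 addr0 addrA.
  by congr (X _ + X _ + X _); apply: val_inj.
move=> w; rewrite /block_circulant3 !mul_row_col !mul_mx_row !add_row_mx.
rewrite -!mulmxDr /w sumX; congr row_mx; last congr row_mx; congr (_ *m _).
- by rewrite -addrA (addrC (X 1)).
- by rewrite addrA (addrC (X 1)).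
- by rewrite addrC (addrC (X 1)).
Qed.

End BlockCirculant.

Theorem theorem4p5 (R : finComUnitRingType)
  (frobR : frobenius_ring R) (char2 : 2%N \in [pchar R])
  (p k : nat) (p_prime : prime p) (p_eq : p = (4 * k + 1)%N)
  (a b c : 'I_3 -> R) (A : 'I_3 -> 'M[R]_p)
  (A_circ : forall i, is_circulant (A i)) :
  let Q := fun i : 'I_3 => Q_mx p (a i) (b i) (c i) in
  let M := row_mx (block_circulant3 Q) (block_circulant3 A) in
  self_dual (row_code M) -> \sum_(i < 3) Q i \in unitmx.
Proof.
case: p p_prime p_eq A A_circ => [|[|n]] // p_pr pE {}A A_circ Q M sdM.
pose S := \sum_(i < 3) Q i; pose B := \sum_(i < 3) A i.
have sum_circ (X : 'I_3 -> 'M[R]_n.+2) :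
    (forall i, is_circulant (X i)) -> is_circulant (\sum_(i < 3) X i).
  move=> X_circ; rewrite 3!big_ord_recl big_ord0 addr0.
  by do ?apply: is_circulantD.
have S_circ : is_circulant S by apply: sum_circ => i; eexists.
have B_circ : is_circulant B by apply: sum_circ.
have S_sym : S^T = S.
  by rewrite /S raddf_sum; apply: eq_bigr => i _; apply: (trmx_Q_mx _ _ _ p_pr pE).
have rowsM m (v : 'M[R]_(m, n.+2)) : row_mx v (row_mx v v) *m M =
    row_mx (row_mx (v *m S) (row_mx (v *m S) (v *m S)))
           (row_mx (v *m B) (row_mx (v *m B) (v *m B))).
  by rewrite mul_mx_row !sum_block_rows.
(* 3 X = X in characteristic 2. *)
have triple (X : 'M[R]_n.+2) : X + (X + X) = X.
  by rewrite -mulr2n -scaler_nat (pcharf0 char2) scale0r addr0.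
apply: (@unitmx_of_mul_tr0 _ _ S B (flip_mx R n)).
- exact: circulant_mulC.
- by rewrite -(circulant_flip S_circ) S_sym.
- exact: circulant_flip.
- exact: unitmx_perm.
- pose E : 'M[R]_(n.+2, _) := row_mx 1%:M (row_mx 1%:M 1%:M).
  have : E *m M *m (E *m M)^T = 0.
    by rewrite trmx_mul mulmxA -(mulmxA E) (self_dual_mul_tr sdM) mulmx0 mul0mx.
  by rewrite rowsM !mul1mx !tr_row_mx !mul_row_col !triple.
- move=> v vS0 vB0.
  have : row_mx v (row_mx v v) *m M = 0 by rewrite rowsM vS0 vB0 !row_mx0.
  move=> /(self_dual_row_free sdM).
  by rewrite -[RHS](@row_mx0 R 1 n.+2 _) => /eq_row_mx[].
Qed.
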